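(* Suppose $Y\sim\sum_{k=1}^K\pi_kT_\nu(\mu_k,\omega^2)$, with $\sum_{k=1}^K\pi_k=1$, where $T_\nu(\mu,\omega^2)$ is the $t$ distribution with location parameter $\mu$, scale parameter $\omega^2>0$ and $\nu>0$ degrees of freedom, and $K$, the mixing proportions $\pi_k$, the locations $\mu_k\in\mathbb{R}$, $\omega^2$ and $\nu$ are all unknown. Suppose $P(R=1\mid Y=y)=F(\alpha+\beta y)$ with unknown $\alpha,\beta\in\mathbb{R}$ and a known strictly monotone distribution function $F$ with support on $(-\infty,+\infty)$ satisfying the following condition: for every $\theta_0\in(-\infty,\infty)$, $\theta_1>0$ and $M>0$, at most one of the limits $$\lim_{z\to+\infty}z^M\{F(\theta_0+\theta_1z)-F(z)\}\quad\text{and}\quad\lim_{z\to-\infty}|z|^M\{1-F(\theta_0+\theta_1z)/F(z)\}$$ is finite and positive. Then all the parameters $K$, $\{(\pi_k,\mu_k):k=1,\ldots,K\}$, $\omega^2$, $\nu$, $\alpha$ and $\beta$ are identifiable.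
   Context: $Y$ is an outcome variable and $R\in\{0,1\}$ is its missingness indicator ($R=1$ if $Y$ is observed). The observed distribution is $P(y,R=1)$, which here is the function $y\mapsto\sum_{k=1}^K\frac{\pi_k}{\omega}t_\nu\left(\frac{y-\mu_k}{\omega}\right)F(\alpha+\beta y)$, where $t_\nu(z)\propto(1+z^2/\nu)^{-(\nu+1)/2}$ is the standard $t$ density with $\nu$ degrees of freedom. Mixtures are written with $\pi_k>0$ and distinct locations $\mu_k$. The parameters are identifiable if any two parameter sets yielding the same observed distribution have the same $K$, the same set $\{(\pi_k,\mu_k)\}$ (i.e. equality up to relabelling of components), and the same $\omega^2,\nu,\alpha,\beta$. *)

(* Defs.v *)
From HB Require Import structures.
From mathcomp Require Import all_boot all_order all_algebra.
From mathcomp Require Import all_classical all_reals all_analysis.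
Set Implicit Arguments.
Unset Strict Implicit.
Unset Printing Implicit Defensive.
Import Order.TTheory GRing.Theory Num.Theory.
Import numFieldNormedType.Exports.
Local Open Scope classical_set_scope.
Local Open Scope ring_scope.

Definition t_kernel (R : realType) (nu z : R) : R :=
  (1 + z ^+ 2 / nu) `^ (- ((nu + 1) / 2)).

(* The usual constant Gamma((nu+1)/2) / (sqrt (nu pi) Gamma(nu/2)) is, for
   [0 < nu], the inverse of the integral of the kernel. *)
Definition t_pdf (R : realType) (nu z : R) : R :=
  t_kernel nu z / \int[lebesgue_measure]_x t_kernel nu x.

(* The selection parameters [alpha] and [beta] are those of
   P(R = 1 | Y = y) = F (alpha + beta y). *)
Record t_mixture_params (R : realType) := TMixtureParams {
  ncomp : nat ;
  prop : 'I_ncomp -> R ;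
  loc : 'I_ncomp -> R ;
  omega2 : R ;
  nu : R ;
  alpha : R ;
  beta : R }.

Arguments prop [R] p k : rename.
Arguments loc [R] p k : rename.

Definition omega (R : realType) (p : t_mixture_params R) : R :=
  Num.sqrt (omega2 p).

(* A mixture has at least one component because the proportions sum to 1. *)
Definition admissible (R : realType) (p : t_mixture_params R) : Prop :=
  [/\ forall k, 0 < prop p k,
      \sum_(k < ncomp p) prop p k = 1,
      injective (loc p),
      0 < omega2 p &
      0 < nu p].

(* The function y |-> P(y, R = 1). *)
Definition observed (R : realType) (F : R -> R) (p : t_mixture_params R)
    (y : R) : R :=
  \sum_(k < ncomp p)
    prop p k / omega p * t_pdf (nu p) ((y - loc p k) / omega p)
      * F (alpha p + beta p * y).

Definition components (R : realType) (p : t_mixture_params R) : set (R * R) :=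
  [set (prop p k, loc p k) | k in [set: 'I_(ncomp p)]].

Definition identifiable (R : realType) (F : R -> R) : Prop :=
  forall p q : t_mixture_params R, admissible p -> admissible q ->
    observed F p =1 observed F q ->
    [/\ ncomp p = ncomp q,
        components p = components q,
        omega2 p = omega2 q,
        nu p = nu q &
        alpha p = alpha q /\ beta p = beta q].

(* The topological support of the distribution with distribution function
   [F], as its set of points of increase. *)
Definition cdf_support (R : realType) (F : R -> R) : set R :=
  [set x | forall e, 0 < e -> F (x - e) < F (x + e)].

Definition has_pos_limit (R : realType) (f : R -> R) (G : set_system R) : Prop :=
  exists2 l : R, 0 < l & f @ G --> l.

Definition tail_condition (R : realType) (F : R -> R) : Prop :=
  forall theta0 theta1 M : R, 0 < theta1 -> 0 < M ->
    ~ (has_pos_limit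
         (fun z => z `^ M * (F (theta0 + theta1 * z) - F z)) +oo /\
       has_pos_limit
         (fun z => `|z| `^ M * (1 - F (theta0 + theta1 * z) / F z)) -oo).

(* Main.v *)
From HB Require Import structures.
Require Import Defs.
From mathcomp Require Import all_boot all_order all_algebra.
From mathcomp Require Import all_classical all_reals all_analysis.
From mathcomp Require Import measurable_realfun ring lra zify.
Import Order.TTheory GRing.Theory Num.Theory.
Import numFieldNormedType.Exports.
Local Open Scope classical_set_scope.
Local Open Scope ring_scope.
Set Implicit Arguments.
Unset Strict Implicit.
Unset Printing Implicit Defensive.

(* Put u = 1/y.  The mixture density at 1/u is |u|^(nu+1) times
   g(u) = W sum_k pi_k P_k(u)^(-s), where s = (nu+1)/2 and
   P_k(u) = (1 - mu_k u)^2 + omega^2 nu u^2 is an irreducible quadratic with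
   P_k(0) = 1.  A relation between such powers cannot vanish to infinite order
   at 0: terms are eliminated one by one by first-order differential operators
   while the order of the pole of one term at the roots of its quadratic stays
   positive.  So for equal nu either the two functions g coincide, and then so
   do the mixtures, or their difference is equivalent to C u^M with C <> 0, with
   the same C on both sides of 0.

   Comparing both tails of the observed functions shows that the slopes have
   the same sign and that nu is the same.  If the slopes vanish, the functions g
   are proportional.  Otherwise
   F(alpha + beta y) / F(alpha' + beta' y) - 1 is equivalent to C y^(-M), and
   M > 0.  If M is odd, one of the two orderings of the parameters has both
   limits of the tail condition positive.  If M is even, then beta = beta', and
   F(z + d) / F(z) - 1 is O(z^(-2)) at -oo for some d > 0, which prevents F from
   tending to 0 there. *)

(** * Sums of terms [A * P^(-t)] that vanish to infinite order at 0 *)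

Section Numerators.
Variable R : realFieldType.
Implicit Types (t : R) (P Q A B C : {poly R}) (Ps : seq {poly R}).

(* The derivative of [A * P^(-t)] is [dnum t P A * P^(-(t + 1))]. *)
Definition dnum t P A : {poly R} := A^`() * P - t *: (A * P^`()).

Fixpoint dnums n t P A : {poly R} :=
  if n is n'.+1 then dnums n' (t + 1) P (dnum t P A) else A.

(** The recursion of [dnums] puts the first differentiation innermost; this form exposes the last
    one, as needed to differentiate an [n]-th derivative. *)
Lemma dnumsSr n t P A :
  dnums n.+1 t P A = dnum (t + n%:R) P (dnums n t P A).
Proof.
elim: n t A => [|n IHn] t A; first by rewrite /= addr0.
by rewrite -natr1 [n%:R + 1]addrC addrA -IHn.
Qed.

Lemma dnumD t P A B : dnum t P (A + B) = dnum t P A + dnum t P B.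
Proof. by rewrite /dnum derivD -!mul_polyC; ring. Qed.

Lemma dnumsD n t P A B : dnums n t P (A + B) = dnums n t P A + dnums n t P B.
Proof. by elim: n t A B => //= n IHn t A B; rewrite dnumD IHn. Qed.

Lemma dnum_mul t P A Q : dnum t P (Q * A) = Q^`() * (P * A) + Q * dnum t P A.
Proof. by rewrite /dnum derivM -!mul_polyC; ring. Qed.

(** [P * A] with exponent [t + 1] and [A] with exponent [t] represent the same function, so their
    derivatives agree. *)
Lemma dnum_mulP t P A : dnum (t + 1) P (P * A) = P * dnum t P A.
Proof. by rewrite /dnum derivM -!mul_polyC polyCD; ring. Qed.

Lemma dnums_mulP n t P A : dnums n (t + 1) P (P * A) = P * dnums n t P A.
Proof. by elim: n t A => //= n IHn t A; rewrite dnum_mulP IHn. Qed.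

(** The function differentiated is [A * P^(-(t - k))], whence the coefficient [t - k]. *)
Lemma dnum_mulPk t P A k :
  dnum t P (P ^+ k * A)
  = P ^+ k * (A^`() * P - (t - k%:R) *: (A * P^`())).
Proof.
elim: k t => [|k IHk] t; first by rewrite !expr0 !mul1r subr0.
have -> : t = (t - 1) + 1 by ring.
rewrite exprS -!mulrA dnum_mulP IHk.
by congr (_ * (_ * (_ - _ *: _))); rewrite -natr1; ring.
Qed.

(* When all [P] have constant coefficient [1], this says that all derivatives
   of the sum of the [A P * P^(-t)] vanish at [0]. *)
Definition flat Ps t (A : {poly R} -> {poly R}) :=
  forall n, \sum_(P <- Ps) (dnums n t P (A P)).[0] = 0.

Lemma flat_dnum Ps t (A : {poly R} -> {poly R}) :
  flat Ps t A -> flat Ps (t + 1) (fun P => dnum t P (A P)).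
Proof. by move=> fA n; exact: (fA n.+1). Qed.

Lemma flat_mulP Ps t (A : {poly R} ->
  {poly R}) : {in Ps, forall P, P.[0] = 1} ->
  flat Ps t A -> flat Ps (t + 1) (fun P => P * A P).
Proof.
move=> Ps1 fA n; apply: etrans (fA n); rewrite big_seq [RHS]big_seq.
by apply: eq_bigr => P PPs; rewrite dnums_mulP hornerM (Ps1 P PPs) mul1r.
Qed.

Lemma flatD Ps t (A B : {poly R} -> {poly R}) :
  flat Ps t A -> flat Ps t B -> flat Ps t (fun P => A P + B P).
Proof.
move=> fA fB n; under eq_bigr do rewrite dnumsD hornerD.
by rewrite big_split/= fA fB addr0.
Qed.

(** Leibniz rule: the derivative of [Q f] is [Q' f + Q f'], and both [f], rewritten with exponent
    [t + 1], and [f'] are flat, so induction on the order applies. *)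
Lemma flat_mul Ps t (A : {poly R} ->
  {poly R}) Q : {in Ps, forall P, P.[0] = 1} ->
  flat Ps t A -> flat Ps t (fun P => Q * A P).
Proof.
move=> Ps1 fA n; elim: n t A fA Q => [|n IHn] t A fA Q.
  under eq_bigr do rewrite /= hornerM.
  by rewrite -mulr_sumr (fA 0%N) mulr0.
under eq_bigr do rewrite /= dnum_mul dnumsD hornerD.
rewrite big_split/=.
rewrite (IHn _ (fun P => P * A P)) ?add0r; last exact: flat_mulP.
by rewrite (IHn _ (fun P => dnum t P (A P)))//; exact: flat_dnum.
Qed.

Lemma dnums_Xn r t P B : (P.[0] = 1) ->
  (dnums r t P ('X^r * B)).[0] = (r`!)%:R * B.[0].
Proof.
move=> P1; elim: r t B => [|r IHr] t B; first by rewrite expr0 !mul1r.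
rewrite /= dnum_mul derivXn/=.
set B2 := r.+1%:R%:P * (P * B) + 'X * dnum t P B.
rewrite (_ : _ + _ = 'X^r * B2); last first.
  by rewrite /B2 exprS polyC_natr -mulr_natr; ring.
rewrite IHr /B2 hornerD !hornerM hornerX hornerC P1 mul0r addr0 mul1r.
by rewrite factS natrM; ring.
Qed.

(** If [A] is nonzero, it is ['X^m * B] with [B.[0] != 0], and the [m]-th derivative at 0 is [m! *
    B.[0]]. *)
Lemma flat1_eq0 t P A : P.[0] = 1 -> flat [:: P] t (fun=> A) -> A = 0.
Proof.
move=> P1 fA; apply/eqP/negPn/negP => A0.
have [m [B nrB AE]] := multiplicity_XsubC A 0.
rewrite A0/= in nrB.
have := fA m; rewrite big_seq1 AE subr0 mulrC dnums_Xn// => /eqP.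
rewrite mulf_eq0 pnatr_eq0 eqn0Ngt fact_gt0 => /= B0.
by move: nrB; rewrite /root B0.
Qed.

Lemma irredp_coprime P A : irreducible_poly P -> ~~ (P %| A) -> coprimep P A.
Proof.
move=> irrP PA; have [/eqP//|g1] := eqVneq (size (gcdp P A)) 1%N.
case: irrP => _ /(_ _ g1 (dvdp_gcdl _ _)) gP.
by case/negP: PA; rewrite -(eqp_dvdl _ gP) dvdp_gcdr.
Qed.

Lemma irredp_factor P A : irreducible_poly P -> A != 0 ->
  exists m B, coprimep P B /\ A = P ^+ m * B.
Proof.
move=> irrP; have [n] := ubnP (size A); elim: n A => // n IHn A sA A0.
have [/dvdpP[A' AE]|PA] := boolP (P %| A); last first.
  by exists 0%N, A; rewrite expr0 mul1r; split=> //; exact: irredp_coprime.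
have P0 := irredp_neq0 irrP.
have A'0 : A' != 0 by apply: contraNneq A0 => A'0; rewrite AE A'0 mul0r.
have [|m [B [cB A'E]]] := IHn A' _ A'0.
  move: sA; rewrite AE size_mul//; case: irrP => P1 _.
  move: P1; move: (size P) (size A') => a b; lia.
by exists m.+1, B; split=> //; rewrite AE A'E exprS; ring.
Qed.

(** In characteristic 0 the derivative is nonzero, and it is too small to be a multiple of [P]. *)
Lemma irredp_coprime_deriv P : irreducible_poly P -> coprimep P P^`().
Proof.
move=> irrP; have P0 := irredp_neq0 irrP; apply: irredp_coprime => //.
have sP : (1 < size P)%N by case: irrP.
have dP0 : P^`() != 0.
  apply: contra P0 => /eqP dP; case sE: (size P) sP => [|[|n]]// _.
  have := coef_deriv P n; rewrite dP coef0 -mulr_natr => /esym/eqP.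
  by rewrite mulf_eq0 pnatr_eq0 orbF -lead_coef_eq0 lead_coefE sE.
by apply/negP => /(dvdp_leq dP0); rewrite leqNgt lt_size_deriv.
Qed.

(** Fixing the constant coefficient makes associate polynomials equal, so distinct ones are
    coprime. *)
Definition normalized_irr P := irreducible_poly P /\ P.[0] = 1.

Lemma normalized_irr_coprime P Q :
  normalized_irr P -> normalized_irr Q -> P != Q -> coprimep P Q.
Proof.
move=> [iP P1] [iQ Q1] PQ; apply: irredp_coprime => //; apply: contra PQ => PQ.
have sP1 : size P != 1%N by case: iP; case: size => [|[]].
have /eqp_eq PEQ := iQ.2 P sP1 PQ.
have := congr1 (horner^~ 0) PEQ; rewrite !hornerZ P1 Q1 !mulr1 => lcE.
move: PEQ; rewrite lcE => /(scalerI _) -> //.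
by rewrite lead_coef_eq0 irredp_neq0.
Qed.

(* The first term has a pole of order [t - k] at the roots of [P1]. A first-order
   operator that annihilates the term [A P2 * P2^(-t)], multiplied by [P1],
   preserves this order: the new polar part carries the factor [k - t - m],
   where [m] is the multiplicity of [P1] in [A P2], and [k < t]. *)
Lemma flat_coprime_absurd Ps P1 t k (A : {poly R} -> {poly R}) C :
  {in P1 :: Ps, forall P, normalized_irr P} -> uniq (P1 :: Ps) ->
  A P1 = P1 ^+ k * C -> coprimep P1 C -> k%:R < t -> ~ flat (P1 :: Ps) t A.
Proof.
elim: Ps t k A C => [|P2 Ps IH] t k A C norm /= + AE cC kt fA.
  (* With a single term, flatness gives [A P1 = 0], hence [C = 0]; then [P1], coprime to 0, would be
     constant. *)
  have [iP P1h] := norm P1 (mem_head _ _).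
  have A0 : A P1 = 0.
    apply: (@flat1_eq0 t P1) => // n.
    by rewrite big_seq1; have := fA n; rewrite big_seq1.
  move/eqP: A0; rewrite AE mulf_eq0 expf_eq0 (negPf (irredp_neq0 iP)) andbF/=.
  move=> /eqP C0; move: cC; rewrite C0 coprimep0 => /eqp_size.
  by rewrite size_poly1 => sP; case: iP; rewrite sP.
rewrite inE negb_or -andbA => /and4P[P12 P1Ps P2Ps uPs].
have norm' : {in P1 :: Ps, forall P, normalized_irr P}.
  by move=> P; rewrite inE => PPs; apply: norm; rewrite !inE;
    case/orP: PPs => ->; rewrite ?orbT.
have u' : uniq (P1 :: Ps) by rewrite /= P1Ps.
have drop2 t' (A' : {poly R} -> {poly R}) :
    A' P2 = 0 -> flat [:: P1, P2 & Ps] t' A' -> flat (P1 :: Ps) t' A'.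
  move=> A'2 fA' n; have := fA' n; rewrite !big_cons A'2.
  suff -> : dnums n t' P2 0 = 0 by rewrite horner0 add0r.
  elim: n t' {fA'} => //= n IHn t'.
  by rewrite (_ : dnum _ _ _ = 0) ?IHn// /dnum derivC !mul0r scaler0 subr0.
have [A20|A20] := eqVneq (A P2) 0.
  exact: (IH t k A C norm' u' AE cC kt (drop2 _ _ A20 fA)).
have N1 := norm P1 (mem_head _ _).
have N2 : normalized_irr P2 by apply: norm; rewrite !inE eqxx orbT.
have hor1 : {in [:: P1, P2 & Ps], forall P, P.[0] = 1} by move=> P /norm[].
have [m [B [cB A2E]]] := irredp_factor N1.1 A20.
(* [S / (B * P1 * P2)] is the logarithmic derivative of [P1 ^+ m * B * P2^(-t)], so the operator in
   [A'] kills the [P2] term. *)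
pose S := m%:R%:P * P1^`() * B * P2 + P1 * B^`() * P2 - t%:P * P1 * B * P2^`().
pose A' P := B * P2 * P1 * dnum t P (A P) + - S * (P * A P).
have fA' : flat [:: P1, P2 & Ps] (t + 1) A'.
  apply: flatD; apply: flat_mul => //; first exact: flat_dnum.
  exact: flat_mulP.
have A'2 : A' P2 = 0.
  have dP : (P1 ^+ m)^`() * P1 = m%:R%:P * P1^`() * P1 ^+ m.
    rewrite deriv_exp polyC_natr; case: m {A2E S A' fA'} => [|m];
      first by rewrite mulr0n; ring.
    by rewrite exprS -mulr_natr/=; ring.
  rewrite /A' /S A2E /dnum derivM -!mul_polyC.
  transitivity (B * P2 * P2 * B
    * ((P1 ^+ m)^`() * P1 - m%:R%:P * P1^`() * P1 ^+ m)).
    ring.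
  by rewrite dP subrr mulr0.
(* [A' P1 = P1 ^+ k.+1 * C'], and modulo [P1] only the first summand of [C'] remains, a product of
   factors coprime to [P1]. *)
pose C' := (k%:R - t - m%:R)%:P * (B * P2 * P1^`() * C)
  + P1 * (B * P2 * C^`() - C * B^`() * P2 + t%:P * C * B * P2^`()).
apply: (IH (t + 1) k.+1 A' C' norm' u' _ _ _ (drop2 _ _ A'2 fA')).
- rewrite /A' AE dnum_mulPk -!mul_polyC /C' /S exprS !polyCB.
  by ring.
- rewrite /C' addrC mulrC coprimep_addl_mul mul_polyC coprimepZr; last first.
    by have : 0 <= m%:R :> R := ler0n _ _; move=> m0; apply/ltr0_neq0; lra.
  by rewrite !coprimepMr cB cC irredp_coprime_deriv
    ?(normalized_irr_coprime N1 N2 P12)//; case: N1.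
- by rewrite -natr1 ltrD2r.
Qed.

End Numerators.

(** * Order of vanishing of a smooth function at 0 *)

Section Taylor.
Variable R : realType.
Implicit Types (t u : R) (Ps : seq {poly R}) (A : {poly R} -> {poly R}).

Lemma is_derive_monomial n u :
  is_derive u 1 (fun v : R => v ^+ n.+1) (n.+1%:R * u ^+ n).
Proof.
rewrite (_ : (fun v => _) = id ^+ n.+1); last by rewrite exprfctE.
by apply: is_derive_eq; rewrite scaler1.
Qed.

(** Induction on [n]: either [H 0 0] is nonzero and [M = 0], or the result for the derivative is
    integrated by l'Hopital's rule. *)
Lemma first_order_equivalent (H : nat -> R -> R) n :
  (forall m u, is_derive u 1 (H m) (H m.+1 u)) -> H n 0 != 0 ->
  exists M : nat, exists2 C : R, C != 0 & H 0%N u / u ^+ M @[u --> 0^'] --> C.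
Proof.
elim: n H => [|n IHn] H dH Hn.
  exists 0%N, (H 0%N 0) => //.
  under eq_fun do rewrite expr0 divr1.
  apply: cvg_within_filter; apply: differentiable_continuous.
  by apply/derivable1_diffP; apply: ex_derive; exact: dH.
have H0c : H 0%N u @[u --> 0] --> H 0%N 0.
  apply: differentiable_continuous.
  by apply/derivable1_diffP; apply: ex_derive; exact: dH.
have [H0|H0] := eqVneq (H 0%N 0) 0; last first.
  exists 0%N, (H 0%N 0) => //.
  under eq_fun do rewrite expr0 divr1.
  exact: cvg_within_filter.
have dH1 m u : is_derive u 1 ((H \o S) m) ((H \o S) m.+1 u) by exact: dH.
have [M [C C0 HC]] := IHn (H \o S) dH1 Hn.
exists M.+1, (C / M.+1%:R); first by rewrite mulf_neq0// invr_neq0// pnatr_eq0.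
have X0 : u ^+ M.+1 @[u --> (0:R)] --> (0:R).
  have := @exprn_continuous R M.+1 0.
  by rewrite /continuous_at exprS mul0r.
have H'C : H 1%N u / (M.+1%:R * u ^+ M) @[u --> 0^'] --> C / M.+1%:R.
  rewrite (_ : (fun u => _) = fun u => (H \o S) 0%N u / u ^+ M / M.+1%:R).
    by apply: cvgMl; exact: HC.
  by apply/funext => u /=; rewrite invfM; ring.
rewrite H0 in H0c.
(* The quotient of derivatives has a two-sided limit, so the rule yields the same constant on either
   side. *)
apply/(@cvg_at_right_left_dnbhs _ R^o).
- apply: (@lhopital_at_right R (H 0%N) (H 1%N) _ (fun u => M.+1%:R * u ^+ M)
      0 1 _ ltr01 (fun x _ => dH 0%N x) (fun x _ => is_derive_monomial M x)).
  + exact: cvg_at_right_filter.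
  + exact: cvg_at_right_filter.
  + move=> x; rewrite in_itv/= => /andP[x0 _].
    by rewrite mulf_neq0 ?pnatr_eq0// expf_neq0// gt_eqF.
  + exact: cvg_dnbhs_at_right.
- apply: (@lhopital_at_left R (H 0%N) (H 1%N) _ (fun u => M.+1%:R * u ^+ M)
      (-1) 0 _ (ltrN10 R) (fun x _ => dH 0%N x) (fun x _ => is_derive_monomial
        M x)).
  + exact: cvg_at_left_filter.
  + exact: cvg_at_left_filter.
  + move=> x; rewrite in_itv/= => /andP[_ x0].
    by rewrite mulf_neq0 ?pnatr_eq0// expf_neq0// lt_eqF.
  + exact: cvg_dnbhs_at_left.
Qed.

Definition ev Ps t A u := \sum_(P <- Ps) (A P).[u] * P.[u] `^ (- t).

Lemma is_derive_ev Ps t A u :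
  {in Ps, forall P, forall v, 0 < P.[v]} ->
  is_derive u 1 (ev Ps t A) (ev Ps (t + 1) (fun P => dnum t P (A P)) u).
Proof.
elim: Ps => [|P Ps IH] Ps0; rewrite /ev.
  rewrite (_ : (fun _ => _) = cst 0); last by apply/funext => v;
    rewrite big_nil.
  by rewrite big_nil; exact: is_derive_cst.
rewrite (_ : (fun _ => _) = horner (A P) * ((powR (R:=R))^~ (- t) \o horner P)
  + ev Ps t A); last first.
  by apply/funext => v; rewrite big_cons.
rewrite big_cons.
have Pu0 : 0 < P.[u] by apply: Ps0; rewrite mem_head.
have dev : is_derive u 1 (ev Ps t A) (ev Ps (t + 1) (fun P => dnum t P (A P))
  u).
  by apply: IH => Q QPs; apply: Ps0; rewrite inE QPs orbT.
have dpow := is_derive1_powR (- t) Pu0.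
apply: is_deriveD.
apply: is_derive_eq; rewrite /dnum !hornerE/= /GRing.scale/=.
(* Both terms of the product rule are brought to the exponent [- t - 1], whence the factor [P] in
   the first term of [dnum]. *)
have -> : P.[u] `^ (- t) = P.[u] * P.[u] `^ (- t - 1).
  by rewrite powRB ?(gt_eqF Pu0)// ?implybT// powRr1 ?ltW//; field;
    rewrite gt_eqF.
have -> : - (t + 1) = - t - 1 by ring.
by ring.
Qed.

(** The [m]-th derivative is [ev] with exponent [t + m] and numerators [dnums m]; at 0 the powers
    are 1, so its values there are the sums in [flat]. *)
Lemma ev_equivalent Ps t A :
  {in Ps, forall P, forall v, 0 < P.[v]} -> {in Ps, forall P, P.[0] = 1} ->
  ~ flat Ps t A ->
  exists M : nat, exists2 C : R,
    C != 0 & ev Ps t A u / u ^+ M @[u --> 0^'] --> C.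
Proof.
move=> Ps0 Ps1; rewrite /flat -existsNP => -[n /eqP nz].
pose H m := ev Ps (t + m%:R) (fun P => dnums m t P (A P)).
have := @first_order_equivalent H n.
rewrite /H addr0/=; apply => [m u|].
  rewrite (_ : (fun P => dnums m.+1 t P (A P)) =
     fun P => dnum (t + m%:R) P (dnums m t P (A P))); last first.
    by apply/funext => P; exact: dnumsSr.
  by rewrite -natr1 addrA; exact: is_derive_ev.
rewrite /ev (_ : \sum_(P <- Ps) _ = \sum_(P <- Ps) (dnums n t P (A P)).[0])//.
rewrite big_seq [RHS]big_seq; apply: eq_bigr => P PPs.
by rewrite (Ps1 P PPs) powR1 mulr1.
Qed.

End Taylor.

(** * Limits of inverses and of real powers *)

Section Limits.
Variable R : realType.

Lemma cvg_invr_pinfty : x^-1 @[x --> +oo] --> (0 : R)^'+.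
Proof.
move=> A [e /= e0 eA]; suff : \forall x \near +oo, A x^-1 by []; near=> x.
have x0 : 0 < x by near: x; apply: nbhs_pinfty_gt; rewrite num_real.
apply: eA; last by rewrite invr_gt0.
rewrite /ball/= sub0r normrN gtr0_norm ?invr_gt0// invf_plt ?posrE//.
by near: x; apply: nbhs_pinfty_gt; rewrite num_real.
Unshelve. all: by end_near. Qed.

Lemma cvg_invr_at_right : x^-1 @[x --> (0 : R)^'+] --> +oo.
Proof.
apply/cvgryPgt => A; near=> x.
have x0 : 0 < x by near: x; exact: nbhs_right_gt.
apply: (@le_lt_trans _ _ `|A|); first exact: ler_norm.
apply: (@lt_trans _ _ (`|A| + 1)); first by rewrite ltrDl.
have A1 : 0 < `|A| + 1 by rewrite ltr_wpDl.
by rewrite -[ltLHS]invrK ltf_pV2 ?posrE ?invr_gt0//.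
Unshelve. all: by end_near. Qed.

Lemma continuous_powRl (a x : R) : 0 < x ->
  {for x, continuous ((powR (R:=R))^~ a)}.
Proof.
move=> x0; apply: differentiable_continuous; apply/derivable1_diffP.
by apply: derivable_powR; rewrite in_itv/= x0.
Qed.

Lemma continuous_powR_shift (a x : R) : 0 < 1 + x ->
  {for x, continuous (fun x : R => (1 + x) `^ a)}.
Proof.
move=> x0; rewrite (_ : (fun x => _) = (powR (R:=R))^~ a \o (fun x :
  R => 1 + x))//.
apply: continuous_comp; last exact: continuous_powRl.
by apply: cvgD; [exact: cvg_cst|exact: cvg_id].
Qed.

Lemma powR_invr (x a : R) : 0 <= x -> x^-1 `^ a = x `^ (- a).
Proof. by move=> x0; rewrite -(powR_inv1 x0) -powRrM mulN1r. Qed.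

Lemma cvg_powRN_pinfty (a : R) : 0 < a -> x `^ (- a) @[x --> +oo] --> (0 : R).
Proof.
move=> a0; have := cvg_comp _ _ cvg_invr_pinfty (powR_cvg0 a0).
apply: cvg_trans; apply: near_eq_cvg; near=> x => /=.
rewrite powR_invr//; by near: x; apply: nbhs_pinfty_ge; rewrite num_real.
Unshelve. all: by end_near. Qed.

End Limits.

(** * Positivity and finiteness of the integral of the [t] kernel *)

Section Kernel.
Variables (R : realType) (nu : R).
Hypothesis nu0 : 0 < nu.
Local Notation mu := (@lebesgue_measure R).
Local Notation s := ((nu + 1) / 2).

Lemma t_kernel_base_gt0 (z : R) : 0 < 1 + z ^+ 2 / nu.
Proof. by rewrite ltr_pwDl// divr_ge0// ?sqr_ge0// ltW. Qed.

Lemma t_kernel_gt0 (z : R) : 0 < t_kernel nu z.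
Proof. by rewrite powR_gt0// t_kernel_base_gt0. Qed.

Lemma continuous_t_kernel : continuous (t_kernel nu).
Proof.
move=> z.
rewrite (_ : t_kernel nu =
    (powR (R:=R))^~ (- ((nu + 1) / 2)) \o (fun z => 1 + z ^+ 2 / nu))//.
apply: continuous_comp.
  apply: cvgD; first exact: cvg_cst.
  by apply: cvgMl; exact: exprn_continuous.
by apply: continuous_powRl; exact: t_kernel_base_gt0.
Qed.

Local Notation c := (2 * (1 + nu)).

Lemma t_kernel_constant_gt0 : 0 < c. Proof. by rewrite mulr_gt0 ?addr_gt0. Qed.

(** The inequality [(1 + z) ^+ 2 <= c * (1 + z ^+ 2 / nu)] is raised to the power [- s]; the
    majorant has an explicit primitive. *)
Lemma t_kernel_le (z : R) : 0 <= z ->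
  t_kernel nu z <= c `^ s * (1 + z) `^ (- nu - 1).
Proof.
have c0 := t_kernel_constant_gt0; move=> z0; rewrite /t_kernel.
have -> : (1 + z) `^ (- nu - 1) = ((1 + z) ^+ 2) `^ (- s).
  by rewrite -powR_mulrn ?addr_ge0// -powRrM; congr powR; field.
rewrite !powRN -[c `^ s]invrK -invfM lef_pV2 ?posrE ?powR_gt0
  ?t_kernel_base_gt0//;
  last by rewrite mulr_gt0 ?invr_gt0 ?powR_gt0 ?exprn_gt0//; lra.
rewrite -powRN -powR_invr ?(ltW c0)// -powRM ?invr_ge0 ?sqr_ge0 ?(ltW c0)//.
have zz : 0 <= z ^+ 2 / nu by rewrite divr_ge0 ?sqr_ge0// ltW.
apply: ge0_ler_powR; rewrite ?nnegrE.
- by lra.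
- by rewrite mulr_ge0 ?invr_ge0 ?sqr_ge0// ltW.
- by rewrite ltW// t_kernel_base_gt0.
- rewrite mulrC ler_pdivrMr//.
  have -> : (1 + z ^+ 2 / nu) * (2 * (1 + nu))
    = 2 + 2 * nu + 2 * (z ^+ 2 / nu) + 2 * z ^+ 2.
    by field; rewrite gt_eqF.
  have := sqr_ge0 (z - 1); move: (z ^+ 2 / nu) zz => w w0; move: nu0; lra.
Qed.

Definition power_primitive (x : R) : R := - (c `^ s / nu) * (1 + x) `^ (- nu).

Lemma is_derive_power_primitive (x : R) : -1 < x ->
  is_derive x 1 power_primitive (c `^ s * (1 + x) `^ (- nu - 1)).
Proof.
move=> x1.
have d1 : is_derive x 1 (fun x : R => 1 + x) 1.
  rewrite (_ : (fun x => _) = cst 1 + id)//.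
  by apply: is_derive_eq; rewrite add0r.
have x10 : 0 < 1 + x by lra.
have dp := is_derive1_powR (- nu) x10.
have dc := is_derive1_comp dp d1.
rewrite (_ : power_primitive =
  cst (- (c `^ s / nu)) * ((powR (R:=R))^~ (- nu) \o (fun x => 1 + x)))//.
apply: is_derive_eq; rewrite /GRing.scale/= mulr0 addr0.
by field; rewrite gt_eqF.
Qed.

Lemma integral_power_tail :
  (\int[mu]_(x in `[0%R, +oo[) (c `^ s * (1 + x) `^ (- nu - 1))%:E
   = (c `^ s / nu)%:E)%E.
Proof.
have dF (x : R) : -1 < x -> derivable power_primitive x 1.
  by move=> x1; have [] := is_derive_power_primitive x1.
rewrite (@ge0_continuous_FTC2y _ _ power_primitive 0 0).
- by rewrite /power_primitive addr0 powR1 sub0e mulr1 -EFinN opprK.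
- by move=> x x0; rewrite mulr_ge0 ?powR_ge0.
- apply: continuous_in_subspaceT => x; rewrite inE/= in_itv/= andbT => x0.
  by apply: cvgMr; apply: continuous_powR_shift; lra.
- rewrite -(mulr0 (- (c `^ s / nu))); apply: cvgMr.
  apply: (@cvg_comp _ _ _ (fun x => 1 + x) ((powR (R:=R))^~ (- nu)) _ +oo).
    by exact: cvg_addrl.
  exact: cvg_powRN_pinfty.
- by move=> x x0; apply: dF; lra.
- apply: cvg_at_right_filter; apply: differentiable_continuous.
  by apply/derivable1_diffP; apply: dF; lra.
- move=> x; rewrite in_itv/= andbT => x0; rewrite derive1E.
  by apply: derive_val; apply: is_derive_power_primitive; lra.
Qed.

(** The real-valued integral would be 0 if the extended one were infinite, so finiteness is needed
    too: it follows from evenness and the majorant on the half-line. The lower bound comes from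
    [[0, 1]]. *)
Lemma t_kernel_integral_gt0 : 0 < \int[mu]_x t_kernel nu x.
Proof.
have mk (D : set R) : measurable_fun D (EFin \o t_kernel nu).
  apply/measurable_EFinP; apply: measurable_funTS.
  by apply: continuous_measurable_fun; exact: continuous_t_kernel.
have k0 (x : R) : (0 <= (t_kernel nu x)%:E)%E by rewrite lee_fin ltW//
  t_kernel_gt0.
rewrite /Rintegral fine_gt0//; apply/andP; split.
  apply: (@lt_le_trans _ _ (\int[mu]_(x in `[0%R, 1%R]) (t_kernel nu x)%:E)%E).
    apply: (@lt_le_trans _ _ (\int[mu]_(x in `[0%R,
      1%R]) (cst (t_kernel nu 1)%:E x))%E).
      rewrite integral_cst//= lebesgue_measure_itv/= lte01 oppr0 adde0 mule1.
      by rewrite lte_fin t_kernel_gt0.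
    apply: ge0_le_integral => //=; first exact: mk.
    move=> x; rewrite in_itv/= => /andP[x0 x1];
      rewrite lee_fin /t_kernel !powRN.
    rewrite lef_pV2 ?posrE ?powR_gt0 ?t_kernel_base_gt0//.
    apply: ge0_ler_powR; rewrite ?nnegrE ?(ltW (t_kernel_base_gt0 _))//.
      by rewrite divr_ge0// addr_ge0// ltW.
    by rewrite lerD2l// ler_pM2r ?invr_gt0// expr1n expr_le1.
  by apply: ge0_subset_integral => //; exact: mk.
rewrite ge0_symfun_integralT//; last 2 first.
- exact: continuous_t_kernel.
- by move=> x; rewrite /t_kernel/= sqrrN.
rewrite (_ : [set x | _] = `[0, +oo[%classic); last first.
  by apply/seteqP; split => x/=; rewrite in_itv/= andbT.
rewrite lte_mul_pinfty// (@le_lt_trans _ _ (c `^ s / nu)%:E)//;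
  last by rewrite ltry.
rewrite -integral_power_tail; apply: ge0_le_integral => //=.
- exact: mk.
- apply/measurable_EFinP; apply: measurable_funM => //.
  apply: (@measurableT_comp _ _ _ _ _ _ ((powR (R:=R))^~ (- nu - 1))).
    exact: measurable_powR.
  exact: measurable_funD.
- by move=> x; rewrite in_itv/= andbT => x0; rewrite lee_fin t_kernel_le.
Qed.
End Kernel.

(** * Expansions in [1 / y] under an affine change of variable *)

Lemma near_fmap (T U : Type) (f : T -> U) (G : set_system T) (H : set_system U)
    (P : set U) :
  f @ G --> H -> (\forall y \near H, P y) -> \forall x \near G, P (f x).
Proof. by move=> fGH PH; exact: (fGH P PH). Qed.

Section InverseLimits.
Variable R : realType.

Lemma cvg_invr_pinfty_dnbhs : x^-1 @[x --> +oo] --> (0 : R)^'.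
Proof.
apply: cvg_trans (@cvg_invr_pinfty R) _.
by move=> A [e /= e0 eA]; exists e => //= x xe x0; apply: eA => //;
  rewrite gt_eqF.
Qed.

Lemma cvg_invr_ninfty_dnbhs : x^-1 @[x --> -oo] --> (0 : R)^'.
Proof.
move=> A [e /= e0 eA]; suff : \forall x \near -oo, A x^-1 by [].
near=> x.
have x0 : x < 0 by near: x; apply: nbhs_ninfty_lt; rewrite num_real.
apply: eA; last by rewrite invr_eq0 lt_eqF.
rewrite /ball/= sub0r -invrN.
have Nx0 : 0 < - x by rewrite oppr_gt0.
rewrite gtr0_norm ?invr_gt0// invf_plt ?posrE//.
rewrite ltrNr; near: x; apply: nbhs_ninfty_lt; rewrite num_real//.
Unshelve. all: by end_near. Qed.

Variables (G : set_system R) (a b : R).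
Hypotheses (FG : ProperFilter G) (b0 : b != 0) (G0 : x^-1 @[x --> G] --> (0 :
  R)^').

Let ne0 : \forall z \near G, z != 0.
Proof.
have : \forall z \near G, z^-1 != 0 := near_fmap G0 (nbhs_dnbhs_neq (0 : R)).
by apply: filterS => z /=; rewrite invr_eq0.
Qed.

Let G00 : x^-1 @[x --> G] --> (0 : R).
Proof.
apply: (cvg_trans G0); exact: cvg_within.
Qed.

Lemma cvg_affine_invr_mul : ((z - a) / b)^-1 * z @[z --> G] --> b.
Proof.
have d1 : 1 - a * z^-1 @[z --> G] --> 1 - a * 0.
  by apply: cvgB; [exact: cvg_cst|apply: cvgMr; exact: G00].
rewrite mulr0 subr0 in d1.
have d2 : (1 - a * z^-1)^-1 @[z --> G] --> (1 : R)^-1.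
  by apply: cvgV d1; rewrite oner_neq0.
have d3 : b * (1 - a * z^-1)^-1 @[z --> G] --> b * 1^-1 by apply: cvgMr d2.
rewrite invr1 mulr1 in d3; apply: cvg_trans d3; apply: near_eq_cvg.
near=> z.
have z0 : z != 0 by near: z; exact: ne0.
(* At [z = a] both sides are 0, as the inverse of 0 is 0. *)
rewrite /= invf_div; have [za|za] := eqVneq (z - a) 0.
  have -> : 1 - a * z^-1 = 0 by rewrite -(mulfV z0) -mulrBl za mul0r.
  by rewrite za !invr0 !mulr0 mul0r.
have -> : 1 - a * z^-1 = (z - a) / z by rewrite mulrBl mulfV.
by field; apply/andP.
Unshelve. all: by end_near. Qed.

Lemma cvg_affine_invr : ((z - a) / b)^-1 @[z --> G] --> (0 : R)^'.
Proof.
have l0 : ((z - a) / b)^-1 @[z --> G] --> (0 : R).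
  have : ((z - a) / b)^-1 * z * z^-1 @[z --> G] --> b * 0.
    by apply: cvgM G00; exact: cvg_affine_invr_mul.
  rewrite mulr0; apply: cvg_trans; apply: near_eq_cvg; near=> z.
  have z0 : z != 0 by near: z; exact: ne0.
  by rewrite /= mulfK.
have nz : \forall z \near G, ((z - a) / b)^-1 != 0.
  have : \forall z \near G, ((z - a) / b)^-1 * z != 0.
    exact: cvgr_neq0 cvg_affine_invr_mul b0.
  by apply: filterS => z; rewrite mulf_eq0 negb_or => /andP[].
move=> A [e /= e0 eA]; near=> z; apply: eA; last by near: z.
by near: z; apply: near_fmap l0 _; exact: nbhsx_ballx.
Unshelve. all: by end_near. Qed.

(** With [y = (z - a) / b] and [u = y^-1], the left side is [(E y / u ^+ M) * (u * z) ^+ M], and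
    [u * z] tends to [b]. *)
Lemma cvg_remainder (E : R -> R) (M : nat) (C : R) :
  E u^-1 / u ^+ M @[u --> 0^'] --> C ->
  E ((z - a) / b) * z ^+ M @[z --> G] --> C * b ^+ M.
Proof.
move=> EC.
have l1 := cvg_comp _ _ cvg_affine_invr EC.
have l2 : (((z - a) / b)^-1 * z) ^+ M @[z --> G] --> b ^+ M.
  exact: (cvg_comp _ _ cvg_affine_invr_mul (@exprn_continuous _ M b)).
have : E (((z - a) / b)^-1)^-1 / ((z - a) / b)^-1 ^+ M
    * (((z - a) / b)^-1 * z) ^+ M @[z --> G]
      --> C * b ^+ M by exact: cvgM l1 l2.
apply: cvg_trans; apply: near_eq_cvg; near=> z.
have : ((z - a) / b)^-1 != 0.
  by near: z; exact: near_fmap cvg_affine_invr (nbhs_dnbhs_neq (0 : R)).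
by move=> nz; rewrite /= invrK exprMn mulrA mulfVK ?expf_neq0.
Unshelve. all: by end_near. Qed.

End InverseLimits.

(** * Decay at [-oo] limited by a bound on ratios *)

Section Telescoping.
Variable R : realType.

(* With [D = B / d], the function [w |-> G w * (1 + D / w)] is nonincreasing
   along the steps [w |-> w + d] near [-oo]; this is the convergence of the
   product of the [1 + B / w^2]. *)
Lemma slow_decay_absurd (G : R -> R) (d B K : R) : 0 < d -> 0 < B ->
  (forall w, 0 < G w) -> G w @[w --> -oo] --> 0 ->
  ~ (forall w, w < - K -> G (w + d) <= G w * (1 + B / w ^+ 2)).
Proof.
move=> d0 B0 G0 Glim step.
pose D := B / d.
have D0 : 0 < D by rewrite divr_gt0.
have DE : D * d = B by rewrite /D divfK// gt_eqF.
pose phi w := 1 + D / w.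
have phi_gt0 w : w < - D -> 0 < phi w.
  move=> wD; have w0 : w < 0 by rewrite (lt_trans wD)// oppr_lt0.
  by rewrite /phi addrC -ltrBlDr sub0r ltr_ndivlMr// mulN1r ltrNr.
(* As [phi (w + d) <= 1], it suffices that [phi w - phi (w + d) = B / (w * (w + d))] is at least
   [B / w ^+ 2]. *)
have phi_step w : w + d < - D -> phi (w + d) * (1 + B / w ^+ 2) <= phi w.
  move=> wD; have wd0 : w + d < 0 by rewrite (lt_trans wD)// oppr_lt0.
  have w0 : w < 0 by rewrite (lt_trans _ wd0)// ltrDl.
  have phi1 : phi (w + d) <= 1.
    by rewrite /phi gerDl pmulr_rle0// invr_le0 ltW.
  have Bw0 : 0 <= B / w ^+ 2 by rewrite divr_ge0 ?sqr_ge0// ltW.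
  apply: (@le_trans _ _ (phi (w + d) + B / w ^+ 2)).
    by rewrite mulrDr mulr1 lerD2l ler_piMl.
  rewrite -lerBrDl.
  have -> : phi w - phi (w + d) = B / (w * (w + d)).
    by rewrite -DE /phi; field; rewrite (lt_eqF w0) (lt_eqF wd0).
  have ww0 : 0 < w * (w + d) by rewrite nmulr_rgt0.
  have w20 : 0 < w ^+ 2 by rewrite expr2 nmulr_rgt0.
  by rewrite ler_pM2l// lef_pV2 ?posrE// expr2 ler_nM2l// lerDl ltW.
have H_step x : x + d < - D -> x < - K ->
    G (x + d) * phi (x + d) <= G x * phi x.
  move=> xD xK.
  apply: (@le_trans _ _ (G x * (1 + B / x ^+ 2) * phi (x + d))).
    by rewrite ler_pM2r ?step// phi_gt0.
  by rewrite -mulrA ler_pM2l// mulrC phi_step.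
pose w0 : R := - (D + `|K| + 1).
have w0D n : w0 - n%:R * d < - D.
  have : 0 <= n%:R * d by rewrite mulr_ge0// ltW.
  by have := normr_ge0 K; rewrite /w0; lra.
have w0K n : w0 - n%:R * d < - K.
  have : 0 <= n%:R * d by rewrite mulr_ge0// ltW.
  by have := ler_norm K; rewrite /w0; lra.
(* Along the points [w0 - n * d], [G * phi] never falls below its value at [w0]; since [phi <= 1]
   there, neither does [G], against its limit 0. *)
have H_iter n : G w0 * phi w0 <= G (w0 - n%:R * d) * phi (w0 - n%:R * d).
  elim: n => [|n IHn]; first by rewrite mul0r subr0.
  have -> : w0 - n.+1%:R * d = w0 - n%:R * d - d by rewrite -natr1; ring.
  apply: le_trans IHn _; set x := w0 - n%:R * d.
  have := @H_step (x - d); rewrite subrK; apply; first exact: w0D.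
  by apply: lt_trans (w0K n); rewrite ltrBlDr ltrDl.
have h0 : 0 < G w0 * phi w0.
  by rewrite mulr_gt0// phi_gt0//; have := w0D 0%N; rewrite mul0r subr0.
have [A [_ GA]] : \forall w \near -oo,
  G w < G w0 * phi w0 by exact: cvgr_lt Glim _ h0.
pose n := Num.bound `|(w0 - A) / d|.
have nA : w0 - n%:R * d < A.
  have : (w0 - A) / d < n%:R by exact: le_lt_trans (ler_norm _)
    (archi_boundP (normr_ge0 _)).
  by rewrite ltr_pdivrMr//; lra.
have := GA _ nA; rewrite ltNge => /negP; apply.
apply: le_trans (H_iter n) _; rewrite ger_pMr//.
rewrite /phi gerDl pmulr_rle0// invr_le0 ltW// (lt_trans (w0D n))//.
by rewrite oppr_lt0.
Qed.

End Telescoping.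

(** * Consequences of the tail condition for ratios of values of [F] *)

Section SelectionTails.
Variables (R : realType) (F : R -> R).
Hypotheses (F_strict : {homo F : x y / x < y})
  (F_Ny : F x @[x --> -oo] --> (0 : R)) (F_y : F x @[x --> +oo] --> (1 : R)).

(** Otherwise strict monotonicity would keep [F] below a negative number near [-oo]. *)
Lemma selection_gt0 x : 0 < F x.
Proof.
rewrite ltNge; apply/negP => Fx.
have Fx1 : F (x - 1) < 0.
  by apply: lt_le_trans Fx; apply: F_strict; rewrite ltrBlDr ltrDl.
have [A [_ FA]] : \forall w \near -oo,
  F (x - 1) < F w by exact: cvgr_gt F_Ny _ Fx1.
have := FA (Num.min (A - 1) (x - 2)).
rewrite gt_min ltrBlDr ltrDl ltr01 => /(_ isT).
rewrite ltNge => /negP; apply; apply/ltW/F_strict.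
by rewrite gt_min; apply/orP; right; lra.
Qed.

Hypothesis F_tails : tail_condition F.

Section Remainder.
Variables (a b a' b' : R) (E : R -> R) (M : nat) (C : R).
Hypotheses (b0 : 0 < b) (b'0 : 0 < b')
  (FE : forall y, F (a + b * y) = F (a' + b' * y) * (1 + E y))
  (M0 : (0 < M)%N) (EC : E u^-1 / u ^+ M @[u --> 0^'] --> C).

(** The map [z |-> th0 + th1 * z] sends [a' + b' * y] to [a + b * y]; it is the rescaling used in
    the tail condition. *)
Let th1 := b / b'.
Let th0 := a - th1 * a'.

Let FzE z : F (th0 + th1 * z) = F z * (1 + E ((z - a') / b')).
Proof.
have -> : th0 + th1 * z = a + b * ((z - a') / b').
  by rewrite /th0 /th1; field; rewrite gt_eqF.
by rewrite FE; congr (F _ * _); field; rewrite gt_eqF.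
Qed.

Let b'_neq0 : b' != 0. Proof. by rewrite gt_eqF. Qed.

(** If [C] were positive, both limits of the tail condition would equal [C * b' ^+ M]: at [+oo]
    because [F] tends to 1, at [-oo] because [|z| ^+ M = - z ^+ M]. *)
Lemma odd_remainder_le0 : odd M -> C <= 0.
Proof.
move=> oM; rewrite leNgt; apply/negP => C0.
have M0' : 0 < M%:R :> R by rewrite ltr0n.
have th10 : 0 < th1 by rewrite divr_gt0.
have Cb0 : 0 < C * b' ^+ M by rewrite mulr_gt0// exprn_gt0.
apply: (@F_tails th0 th1 M%:R th10 M0'); split; exists (C * b' ^+ M) => //.
- have L : F z * (E ((z - a') / b') * z ^+ M) @[z --> +oo]
    --> 1 * (C * b' ^+ M).
    by apply: cvgM => //; apply: (@cvg_remainder R _ a' b' _ b'_neq0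
      (@cvg_invr_pinfty_dnbhs R) E M C EC).
  rewrite mul1r in L; apply: cvg_trans L; apply: near_eq_cvg; near=> z.
  have z0 : 0 <= z by near: z; apply: nbhs_pinfty_ge; rewrite num_real.
  by rewrite /= FzE powR_mulrn//; ring.
- have L : E ((z - a') / b') * z ^+ M @[z --> -oo] --> C * b' ^+ M.
    exact: (@cvg_remainder R _ a' b' _ b'_neq0 (@cvg_invr_ninfty_dnbhs R) E M C
      EC).
  apply: cvg_trans L; apply: near_eq_cvg; near=> z.
  have z0 : z <= 0 by near: z; apply: nbhs_ninfty_le; rewrite num_real.
  rewrite /= FzE powR_mulrn// ler0_norm// exprNn -signr_odd oM expr1.
  by have := selection_gt0 z => Fz; field; rewrite gt_eqF.
Unshelve. all: by end_near. Qed.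

(** If [C] were positive, [E] would be positive near both infinities, so one affine function would
    exceed the other at both ends, forcing [b = b'] and [a > a']. As [M >= 2], [E y] is at most
    [(C + 1) / y ^+ 2] for large [|y|], and [slow_decay_absurd] applies. *)
Lemma even_remainder_le0 : ~~ odd M -> C <= 0.
Proof.
move=> eM; rewrite leNgt; apply/negP => C0.
have M2 : (2 <= M)%N by case: M M0 eM => [|[]].
have up : \forall u \near (0 : R)^', E u^-1 / u ^+ M < C + 1.
  by apply: cvgr_lt EC _ _; rewrite ltrDl.
have lo : \forall u \near (0 : R)^', 0 < E u^-1 / u ^+ M.
  by apply: cvgr_gt EC _ _.
have [e /= e0 He] : \forall u \near (0 : R)^', 0 < E u^-1 <= (C + 1) * u ^+ 2.
  near=> u.
  have u0 : u != 0 by near: u; exact: nbhs_dnbhs_neq.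
  have uM : 0 < u ^+ M by rewrite exprn_even_gt0 ?u0 ?orbT.
  apply/andP; split.
    suff : 0 < E u^-1 / u ^+ M by rewrite pmulr_lgt0 ?invr_gt0.
    by near: u.
  have : E u^-1 / u ^+ M < C + 1 by near: u.
  rewrite ltr_pdivrMr// => /ltW/le_trans; apply.
  rewrite ler_pM2l; last by rewrite addr_gt0.
  have u1 : `|u| <= 1.
    near: u; exists 1 => //= u; rewrite /ball/= sub0r normrN => /ltW u1 _;
      exact: u1.
  have := ler_wiXn2l (normr_ge0 u) u1 M2.
  by rewrite -!normrX !ger0_norm ?sqr_ge0// ltW.
pose K := e^-1.
have K0 : 0 < K by rewrite invr_gt0.
have Ebound y : K < `|y| -> 0 < E y <= (C + 1) * y^-1 ^+ 2.
  move=> Ky; have y0 : 0 < `|y| by exact: lt_trans Ky.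
  have := He y^-1; rewrite invrK; apply; last by rewrite invr_eq0 -normr_gt0.
  by rewrite /ball/= sub0r normrN normfV invf_plt ?posrE.
have F_mono x y : F x < F y -> x < y.
  by rewrite !ltNge; apply: contra;
    rewrite le_eqVlt => /predU1P[->//|/F_strict/ltW].
have ab y : K < `|y| -> a' + b' * y < a + b * y.
  move=> /Ebound /andP[Ey _]; apply: F_mono; rewrite FE.
  by rewrite mulrDr mulr1 ltrDl mulr_gt0 ?selection_gt0.
have bb' : b = b'.
  apply/eqP; rewrite eq_sym -subr_eq0; apply/negPn/negP => bb'.
  have nb : 0 < `|b' - b| by rewrite normr_gt0.
  (* At [y = sg (b' - b) * r] the difference [(b - b') * y] is [- |b' - b| * r], which outweighs
     [a - a']. *)
  set r := K + 1 + `|a - a'| / `|b' - b|.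
  have r0 : 0 <= `|a - a'| / `|b' - b| by rewrite divr_ge0.
  have Kr : K < `|Num.sg (b' - b) * r|.
    rewrite normrM normr_sg bb' mul1r (lt_le_trans _ (ler_norm _))//.
    by rewrite /r -addrA ltrDl ltr_pwDl.
  have := ab _ Kr.
  have -> : b * (Num.sg (b' - b) * r)
    = b' * (Num.sg (b' - b) * r) - `|b' - b| * r.
    by rewrite normrEsg; ring.
  have -> : `|b' - b| * r = `|b' - b| * (K + 1) + `|a - a'|.
    by rewrite /r mulrDr mulrCA mulfV ?gt_eqF// mulr1.
  have := ler_norm (a - a').
  have : 0 < `|b' - b| * (K + 1) by rewrite mulr_gt0// addr_gt0.
  lra.
have aa' : 0 < a - a'.
  have K1 : K < `|K + 1| by rewrite (lt_le_trans _ (ler_norm _))// ltrDl.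
  by have := ab _ K1; rewrite bb' ltrD2r subr_gt0.
(* Substituting [w = b' * y] turns the bound [(C + 1) / y ^+ 2] into [B / w ^+ 2], and [|y| > K]
   into [w < - (K * b')] on the negative side. *)
pose B := (C + 1) * b' ^+ 2.
apply: (@slow_decay_absurd R (fun w => F (w + a')) (a - a') B (K * b') aa').
- by rewrite mulr_gt0 ?addr_gt0 ?exprn_gt0.
- by move=> w; exact: selection_gt0.
- apply: (@cvg_comp _ _ _ (fun w => w + a') F -oo -oo) => //.
  exact: cvg_addrr_Ny.
- move=> w wK.
  have wb : w / b' < - K by rewrite ltr_pdivrMr// mulNr.
  have -> : w + (a - a') + a' = a + b * (w / b').
    by rewrite bb'; field.
  rewrite FE.
  have -> : a' + b' * (w / b') = w + a' by field.
  rewrite ler_pM2l ?selection_gt0// lerD2l.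
  have /Ebound/andP[_] : K < `|w / b'| by rewrite ltrNr in wb;
    apply: lt_le_trans wb _; rewrite -normrN ler_norm.
  move=> /le_trans; apply; rewrite /B -mulrA ler_pM2l ?addr_gt0//.
  by rewrite invf_div exprMn exprVn.
Unshelve. all: by end_near. Qed.

End Remainder.

(** Exchanging the two affine functions replaces [E] by [- E / (1 + E)] and [C] by [- C], as [E]
    tends to 0; so both [C] and [- C] are nonpositive. *)
Lemma pos_remainder_eq0 (a b a' b' : R) (E : R -> R) (M : nat) (C : R) :
  0 < b -> 0 < b' ->
  (forall y, F (a + b * y) = F (a' + b' * y) * (1 + E y)) ->
  (0 < M)%N -> E u^-1 / u ^+ M @[u --> 0^'] --> C -> C = 0.
Proof.
move=> b0 b'0 FE M0 EC.
have C_le0 a1 b1 a2 b2 E1 C1 : 0 < b1 -> 0 < b2 ->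
    (forall y, F (a1 + b1 * y) = F (a2 + b2 * y) * (1 + E1 y)) ->
    E1 u^-1 / u ^+ M @[u --> 0^'] --> C1 -> C1 <= 0.
  move=> b10 b20 FE1 EC1; have [oM|eM] := boolP (odd M).
    exact: (odd_remainder_le0 b10 b20 FE1 M0 EC1 oM).
  exact: (even_remainder_le0 b20 FE1 M0 EC1 eM).
apply/eqP; rewrite eq_le (C_le0 _ _ _ _ _ _ b0 b'0 FE EC)/= -oppr_le0.
have E1 y : 0 < 1 + E y.
  by have := selection_gt0 (a + b * y); rewrite FE pmulr_rgt0// selection_gt0.
have E0 : E u^-1 @[u --> (0 : R)^'] --> (0 : R).
  have X0 : u ^+ M @[u --> (0 : R)^'] --> (0 : R).
    apply: cvg_within_filter; have := @exprn_continuous R M 0.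
    by rewrite /continuous_at expr0n gtn_eqF.
  have : E u^-1 / u ^+ M * u ^+ M @[u --> 0^'] --> C * 0 by exact: cvgM.
  rewrite mulr0; apply: cvg_trans; apply: near_eq_cvg; near=> u.
  have u0 : u != 0 by near: u; exact: nbhs_dnbhs_neq.
  by rewrite /= mulfVK// expf_neq0.
apply: (C_le0 a' b' a b (fun y => - E y / (1 + E y)) _ b'0 b0).
  move=> y; rewrite FE; have := E1 y => E1y.
  by field; rewrite gt_eqF.
have E1lim : 1 + E u^-1 @[u --> (0 : R)^'] --> (1 + 0 : R).
  by apply: cvgD => //; exact: cvg_cst.
have E1V : (1 + E u^-1)^-1 @[u --> (0 : R)^'] --> (1 + 0 : R)^-1.
  by apply: cvgV E1lim; rewrite addr0 oner_neq0.
have : - (E u^-1 / u ^+ M * (1 + E u^-1)^-1) @[u --> (0 : R)^']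
  --> - (C * (1 + 0)^-1).
  by apply: cvgN; exact: cvgM.
rewrite addr0 invr1 mulr1; apply: cvg_trans; apply: near_eq_cvg.
by near=> u; rewrite /= mulNr mulNr mulrAC.
Unshelve. all: by end_near. Qed.

Lemma cvg_dnbhs0N : - u @[u --> (0 : R)^'] --> (0 : R)^'.
Proof.
move=> A [e /= e0 eA]; exists e => //= u ue u0; apply: eA.
  by move: ue; rewrite /ball/= !sub0r !normrN.
by rewrite oppr_eq0.
Qed.

(** When both slopes are negative, [y |-> - y] makes them positive and multiplies [C] by
    [(-1) ^+ M]. *)
Lemma remainder_eq0 (a b a' b' : R) (E : R -> R) (M : nat) (C : R) :
  0 < b * b' ->
  (forall y, F (a + b * y) = F (a' + b' * y) * (1 + E y)) ->
  (0 < M)%N -> E u^-1 / u ^+ M @[u --> 0^'] --> C -> C = 0.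
Proof.
move=> bb' FE M0 EC; have [b0|b0] := ltP 0 b.
  by apply: (pos_remainder_eq0 b0 _ FE M0 EC); move: bb'; rewrite pmulr_rgt0.
have {}b0 : b < 0 by rewrite lt_neqAle b0 andbT; apply: contraTneq bb' => ->;
  rewrite mul0r ltxx.
have b'0 : b' < 0 by move: bb'; rewrite nmulr_rgt0.
have : (-1) ^+ M * C = 0.
  apply: (@pos_remainder_eq0 a (- b) a' (- b') (fun y => E (- y)) M) => //.
  - by rewrite oppr_gt0.
  - by rewrite oppr_gt0.
  - by move=> y; rewrite !mulNr -!mulrN FE.
  have : (-1) ^+ M * (E (- u)^-1 / (- u) ^+ M) @[u --> 0^'] --> (-1) ^+ M * C.
    by apply: cvgMr; exact: (cvg_comp _ _ cvg_dnbhs0N EC).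
  apply: cvg_trans; apply: near_eq_cvg; near=> u.
  rewrite /= invrN [(- u) ^+ M]exprNn invfM invr_sign.
  by rewrite mulrCA [X in _ * X]mulrA -exprMn mulrNN mulr1 expr1n mul1r.
by move/eqP; rewrite mulf_eq0 signr_eq0 => /eqP.
Unshelve. all: by end_near. Qed.

End SelectionTails.

(** * Linear independence of powers of irreducible quadratics *)

Section Independence.
Variable R : realFieldType.
Implicit Types (Ps : seq {poly R}) (c : {poly R} -> R).

(** A nonzero constant is coprime to its [P1], which gives a pole of order [t > 0]:
    [flat_coprime_absurd] with [k = 0]. *)
Lemma flat_const_eq0 Ps (t : R) c : {in Ps, forall P, normalized_irr P} ->
  uniq Ps -> 0 < t -> flat Ps t (fun P => (c P)%:P) ->
    {in Ps, forall P, c P = 0}.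
Proof.
move=> norm uPs t0 fc P1 P1Ps; apply/eqP/negPn/negP => c1.
have pPs := perm_to_rem P1Ps.
apply: (@flat_coprime_absurd R (rem P1 Ps) P1 t 0 (fun P => (c P)%:P)
  (c P1)%:P) => //.
- by move=> P; rewrite -(perm_mem pPs); exact: norm.
- by rewrite -(perm_uniq pPs).
- by rewrite expr0 mul1r.
- by rewrite -(mulr1 (c P1)%:P) mul_polyC coprimepZr// coprimep1.
- by move=> n; rewrite -(perm_big _ pPs); exact: fc.
Qed.

(** At [u = y^-1] this is [((y - m) ^+ 2 + d) / y ^+ 2]. *)
Definition quad (m d : R) : {poly R} := Poly [:: 1; - (2 * m); m ^+ 2 + d].

Lemma horner_quad m d u : (quad m d).[u] = (1 - m * u) ^+ 2 + d * u ^+ 2.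
Proof. by rewrite horner_Poly/=; ring. Qed.

Lemma horner_quad0 m d : (quad m d).[0] = 1.
Proof. by rewrite horner_quad; ring. Qed.

Lemma horner_quad_gt0 m d u : 0 < d -> 0 < (quad m d).[u].
Proof.
move=> d0; rewrite horner_quad; have [->|u0] := eqVneq u 0.
  by rewrite !mulr0 expr0n/= mulr0 subr0 addr0 expr1n.
by rewrite ltr_wpDl ?sqr_ge0// mulr_gt0// exprn_even_gt0.
Qed.

Lemma polyseq_quad m d : 0 < d ->
  quad m d = [:: 1; - (2 * m); m ^+ 2 + d] :> seq R.
Proof.
by move=> d0; apply: (@PolyK _ 0); rewrite /= gt_eqF// ltr_wpDl ?sqr_ge0.
Qed.

Lemma quad_inj m d m' d' : 0 < d -> 0 < d' -> quad m d = quad m' d' ->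
  m = m' /\ d = d'.
Proof.
move=> d0 d'0 /(congr1 (@polyseq R)); rewrite !polyseq_quad// => -[E1 E2].
have mm : m = m' by lra.
by split=> //; move: E2; rewrite mm => /addrI.
Qed.

Lemma normalized_irr_quad m d : 0 < d -> normalized_irr (quad m d).
Proof.
move=> d0; split; last exact: horner_quad0.
apply: cubic_irreducible; first by rewrite polyseq_quad.
by move=> x; rewrite /root gt_eqF// horner_quad_gt0.
Qed.

(** Since locations are distinct, each sum has at most one term; since [c k] is positive, the sum on
    the other side cannot be empty. *)
Lemma weights_match (K K' : nat) (c mu : 'I_K -> R) (c' mu' : 'I_K' -> R)
    (d d' : R) :
  0 < d -> 0 < d' -> injective mu -> injective mu' ->
  (forall k, 0 < c k) ->
  (forall k, \sum_(i | quad (mu i) d == quad (mu k) d) c i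
           = \sum_(j | quad (mu' j) d' == quad (mu k) d) c' j) ->
  forall k, exists j, [/\ mu' j = mu k, d' = d & c' j = c k].
Proof.
move=> d0 d'0 imu imu' c0 cc' k.
have sumk : \sum_(i | quad (mu i) d == quad (mu k) d) c i = c k.
  rewrite (big_pred1 k)// => i; apply/eqP/eqP => [|->//].
  by move=> /quad_inj[]// /imu.
have [j /eqP jk|none] := pickP (fun j => quad (mu' j) d' == quad (mu k) d).
  have [muj dd] := quad_inj d'0 d0 jk.
  exists j; split=> //; rewrite -sumk cc' (big_pred1 j)// => i.
  apply/eqP/eqP => [|->//]; rewrite -jk.
  by move=> /quad_inj[]// /imu'.
have ck : c k = 0 by rewrite -sumk cc' big_pred0.
by have := c0 k; rewrite ck ltxx.
Qed.

End Independence.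

(** * Limits that determine the exponent and the sign of the slope *)

Section ParameterLimits.
Variable R : realType.

Lemma powR_cvg_eq0 (a l : R) : 0 < l -> v `^ a @[v --> (0 : R)^'+] --> l ->
  a = 0.
Proof.
move=> l0 al; have [a0|a0|//] := ltgtP a 0; last first.
  have le0 : l = 0 by exact: cvg_unique al (powR_cvg0 a0).
  by move: l0; rewrite le0 ltxx.
have na0 : 0 < - a by rewrite oppr_gt0.
have : v `^ a * v `^ (- a) @[v --> (0 : R)^'+] --> l * 0.
  by apply: cvgM => //; exact: powR_cvg0.
rewrite mulr0 => L.
have L1 : v `^ a * v `^ (- a) @[v --> (0 : R)^'+] --> (1 : R).
  have : cst 1 v @[v --> (0 : R)^'+] --> (1 : R) by exact: cvg_cst.
  apply: cvg_trans; apply: near_eq_cvg; near=> v.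
  have v0 : 0 < v by near: v; exact: nbhs_right_gt.
  by rewrite powRN mulfV// gt_eqF// powR_gt0.
have /eqP : 0 = 1 :> R by exact: cvg_unique L L1.
by rewrite eq_sym oner_eq0.
Unshelve. all: by end_near. Qed.

Variable F : R -> R.
Hypotheses (F_Ny : F x @[x --> -oo] --> (0 : R))
  (F_y : F x @[x --> +oo] --> (1 : R)).

Definition selection_limit (a b : R) : R :=
  if 0 < b then 1 else if b < 0 then 0 else F a.

Lemma cvg_selection (a b : R) :
  F (a + b * v^-1) @[v --> (0 : R)^'+] --> selection_limit a b.
Proof.
rewrite /selection_limit.
have [b0|b0|b0] := ltgtP 0 b.
- apply: (@cvg_comp _ _ _ (fun v => a + b * v^-1) F _ +oo) => //.
  apply: (@cvg_comp _ _ _ (fun v => b * v^-1) (fun x => a + x) _ +oo).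
    by apply: gt0_cvgMry => //; exact: cvg_invr_at_right.
  exact: cvg_addrl.
- have L : b * v^-1 @[v --> (0 : R)^'+] --> -oo.
    under eq_fun do rewrite -mulrNN.
    apply: gt0_cvgMrNy; first by rewrite oppr_gt0.
    exact: (iffRL (cvgNrNy _) (@cvg_invr_at_right R)).
  apply: (@cvg_comp _ _ _ (fun v => a + b * v^-1) F _ -oo) => //.
  exact: (@cvg_comp _ _ _ (fun v => b * v^-1) (fun x => a + x) _ -oo _ L
    (@cvg_addrl_Ny R a)).
- rewrite -b0; under eq_fun do rewrite mul0r addr0.
  exact: cvg_cst.
Qed.

End ParameterLimits.

(** * The mixture density in the coordinate [u = 1 / y] *)

Definition half_order (R : realType) (p : t_mixture_params R) : R :=
  (nu p + 1) / 2.

Definition spread (R : realType) (p : t_mixture_params R) : R :=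
  omega2 p * nu p.

(* Locked, for the conversion of two instances would unfold the integral. *)
HB.lock Definition tail_weight (R : realType) (p : t_mixture_params R) : R :=
  spread p `^ half_order p
  / (omega p * \int[lebesgue_measure]_x t_kernel (nu p) x).

Section MixtureAtInfinity.
Variable R : realType.
Implicit Types (p q : t_mixture_params R) (u : R).

(* The mixture density at [u^-1], divided by [|u|^(nu + 1)]. *)
Definition density_at_infinity p u : R :=
  \sum_(k < ncomp p)
    tail_weight p * prop p k * (quad (loc p k) (spread p)).[u]
      `^ (- half_order p).

Lemma spread_gt0 p : admissible p -> 0 < spread p.
Proof. by case=> _ _ _ o0 n0; rewrite mulr_gt0. Qed.

Lemma omega_gt0 p : admissible p -> 0 < omega p.
Proof. by case=> _ _ _ o0 _; rewrite sqrtr_gt0. Qed.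

Lemma half_order_gt0 p : admissible p -> 0 < half_order p.
Proof. by case=> _ _ _ _ n0; rewrite divr_gt0// addr_gt0. Qed.

Lemma tail_weight_gt0 p : admissible p -> 0 < tail_weight p.
Proof.
move=> ap; rewrite tail_weight.unlock divr_gt0 ?powR_gt0 ?spread_gt0//
  mulr_gt0 ?omega_gt0//.
by case: ap => _ _ _ _ n0; exact: t_kernel_integral_gt0.
Qed.

Lemma eq_tail_weight p q : nu p = nu q -> omega2 p = omega2 q ->
  tail_weight p = tail_weight q.
Proof. by rewrite tail_weight.unlock /spread /half_order /omega => -> ->. Qed.

(** For [y = u^-1], the base of the kernel at [(y - m) / omega] is [quad m d] at [u] divided by
    [d * u ^+ 2], where [d] is the spread. *)
Lemma t_pdf_at_infinity p m u : admissible p -> u != 0 ->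
  t_pdf (nu p) ((u^-1 - m) / omega p) / omega p
  = `|u| `^ (nu p + 1)
    * (tail_weight p * (quad m (spread p)).[u] `^ (- half_order p)).
Proof.
move=> ap u0; have o0 := omega_gt0 ap; have d0 := spread_gt0 ap.
have n0 : 0 < nu p by case: ap.
have o2 : omega p ^+ 2 = omega2 p by rewrite sqr_sqrtr// ltW//; case: ap.
have q0 := horner_quad_gt0 m u d0.
rewrite /t_pdf tail_weight.unlock.
have -> : t_kernel (nu p) ((u^-1 - m) / omega p)
    = `|u| `^ (nu p + 1) * spread p `^ half_order p
      * (quad m (spread p)).[u] `^ (- half_order p).
  have -> : `|u| `^ (nu p + 1) = (u ^+ 2) `^ half_order p.
    rewrite -real_normK ?num_real// -powR_mulrn// -powRrM; congr powR.
    by rewrite /half_order; field.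
  rewrite -[half_order p]opprK -!(powR_invr (- half_order p)) ?sqr_ge0
    ?(ltW d0)// opprK.
  rewrite -powRM ?invr_ge0 ?sqr_ge0 ?(ltW d0)//.
  rewrite -powRM ?mulr_ge0 ?invr_ge0 ?sqr_ge0 ?(ltW d0) ?(ltW q0)//.
  congr powR; rewrite horner_quad exprMn exprVn o2 /spread.
  have o20 : omega2 p != 0 by rewrite gt_eqF//; case: ap.
  by field; rewrite u0 o20 gt_eqF.
have i0 := t_kernel_integral_gt0 n0.
by field; rewrite !gt_eqF.
Qed.

Lemma observed_at_infinity (F : R -> R) p u : admissible p -> u != 0 ->
  observed F p u^-1
  = `|u| `^ (nu p + 1) * density_at_infinity p u * F (alpha p + beta p * u^-1).
Proof.
move=> ap u0; rewrite /observed /density_at_infinity mulr_sumr mulr_suml.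
apply: eq_bigr => k _; congr (_ * _).
by rewrite mulrAC mulrA -mulrA t_pdf_at_infinity//; ring.
Qed.

Lemma density_at_infinity_gt0 p u : admissible p -> 0 < density_at_infinity p u.
Proof.
move=> ap; have W0 := tail_weight_gt0 ap; have d0 := spread_gt0 ap.
have q0 k : 0 < (quad (loc p k) (spread p)).[u] by exact: horner_quad_gt0.
case: (ap) => pi0 pi1 _ _ _.
have t0 k : 0 < tail_weight p * prop p k
    * (quad (loc p k) (spread p)).[u] `^ (- half_order p).
  by apply: mulr_gt0; [exact: mulr_gt0|exact: powR_gt0].
rewrite /density_at_infinity lt_neqAle eq_sym; apply/andP; split; last first.
  by apply: sumr_ge0 => k _; exact: ltW.
apply/eqP => z0; have /eqP := pi1; rewrite eq_sym big1 ?oner_eq0// => k _.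
have := psumr_eq0P _ z0 => /(_ (fun i _ => ltW (t0 i)) k isT)/eqP.
by rewrite gt_eqF.
Qed.

Lemma density_at_infinity0 p : admissible p ->
  density_at_infinity p 0 = tail_weight p.
Proof.
case=> _ pi1 _ _ _; rewrite -[RHS]mulr1 -pi1 mulr_sumr; apply: eq_bigr => k _.
by rewrite horner_quad0 powR1 mulr1.
Qed.

(** Terms are collected by quadratic because [ev] indexes numerators by polynomials. [Ps] may be
    larger than needed, so that one list can serve two mixtures. *)
Lemma mixture_ev Ps (t u d : R) K (c mu : 'I_K -> R) : uniq Ps ->
  (forall k, quad (mu k) d \in Ps) ->
  \sum_(k < K) c k * (quad (mu k) d).[u] `^ (- t)
  = ev Ps t (fun P => (\sum_(k < K | quad (mu k) d == P) c k)%:P) u.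
Proof.
move=> uPs muPs; rewrite /ev.
under [RHS]eq_bigr do rewrite hornerC mulr_suml big_mkcond.
rewrite exchange_big/=; apply: eq_bigr => k _.
rewrite (bigD1_seq (quad (mu k) d))//= eqxx big1 ?addr0// => P Pk.
by rewrite eq_sym (negPf Pk).
Qed.

Lemma cvg_density_at_infinity p : admissible p ->
  density_at_infinity p u @[u --> (0 : R)] --> tail_weight p.
Proof.
move=> ap; have d0 := spread_gt0 ap.
pose Ps := undup [seq quad (loc p k) (spread p) | k : 'I_(ncomp p)].
have Ps_in k : quad (loc p k) (spread p) \in Ps.
  by rewrite mem_undup; apply: map_f; rewrite mem_enum.
rewrite -(density_at_infinity0 ap) (_ :
  density_at_infinity p = ev Ps (half_order p)
  (fun P => (\sum_(k | quad (loc p k) (spread p) == P)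
    tail_weight p * prop p k)%:P)); last first.
  by apply/funext => u; apply: mixture_ev => //; exact: undup_uniq.
apply: differentiable_continuous; apply/derivable1_diffP; apply: ex_derive.
apply: is_derive_ev => P; rewrite mem_undup => /mapP[k _ ->] v.
exact: horner_quad_gt0.
Qed.

End MixtureAtInfinity.

(** * Two mixtures with the same degrees of freedom *)

Section Comparison.
Variables (R : realType) (p q : t_mixture_params R).
Hypotheses (ap : admissible p) (aq : admissible q) (nu_pq : nu p = nu q).

(** The difference is an [ev] whose numerators are the constants [c P]. If it is not flat, it has a
    leading term; if it is, all [c P] vanish and the weights match in both directions. The factors
    [l] and [l'] serve for the constant selection probabilities of zero slopes. *)
Lemma density_comparison (l l' : R) : 0 < l -> 0 < l' ->
  (exists M : nat, exists2 C : R, C != 0 &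
     (l * density_at_infinity p u - l' * density_at_infinity q u) / u ^+ M
       @[u --> 0^'] --> C)
  \/ [/\ l = l', ncomp p = ncomp q, components p = components q,
         omega2 p = omega2 q & density_at_infinity p =1 density_at_infinity q].
Proof.
move=> l0 l'0; have dp := spread_gt0 ap; have dq := spread_gt0 aq.
have Wp := tail_weight_gt0 ap; have Wq := tail_weight_gt0 aq.
have s0 := half_order_gt0 ap.
have hpq : half_order q = half_order p by rewrite /half_order nu_pq.
pose quadp k := quad (loc p k) (spread p).
pose quadq k := quad (loc q k) (spread q).
pose Ps := undup ([seq quadp k | k : 'I_(ncomp p)]
  ++ [seq quadq k | k : 'I_(ncomp q)]).
have uPs : uniq Ps by exact: undup_uniq.
have pPs k : quadp k \in Ps.
  by rewrite mem_undup mem_cat map_f// mem_enum.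
have qPs k : quadq k \in Ps.
  by rewrite mem_undup mem_cat orbC map_f// mem_enum.
have Ps_quad P : P \in Ps -> exists m d, 0 < d /\ P = quad m d.
  rewrite mem_undup mem_cat => /orP[] /mapP[k _ ->].
    by exists (loc p k), (spread p).
  by exists (loc q k), (spread q).
pose cp k := l * (tail_weight p * prop p k).
pose cq k := l' * (tail_weight q * prop q k).
pose c P := \sum_(k | quadp k == P) cp k - \sum_(k | quadq k == P) cq k.
have evE u : ev Ps (half_order p) (fun P => (c P)%:P) u
    = l * density_at_infinity p u - l' * density_at_infinity q u.
  rewrite /density_at_infinity !mulr_sumr.
  under [in RHS]eq_bigr do rewrite mulrA -/(cp _).
  under [X in _ = _ - X]eq_bigr do rewrite mulrA -/(cq _) hpq.
  rewrite (mixture_ev _ _ _ uPs pPs) (mixture_ev _ _ _ uPs qPs) /ev -sumrB.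
  by apply: eq_bigr => P _; rewrite !hornerC /c mulrBl.
have [fc|nfc] := pselect (flat Ps (half_order p) (fun P => (c P)%:P));
  last first.
  have Ps_gt0 : {in Ps, forall P, forall v, 0 < P.[v]}.
    by move=> P /Ps_quad[m [d [d0 ->]]] v; exact: horner_quad_gt0.
  have Ps_1 : {in Ps, forall P, P.[0] = 1}.
    by move=> P /Ps_quad[m [d [d0 ->]]]; exact: horner_quad0.
  left; have [M [C C0 MC]] := ev_equivalent Ps_gt0 Ps_1 nfc.
  by exists M, C => //; under eq_fun do rewrite -evE.
have c0 : {in Ps, forall P, c P = 0}.
  apply: flat_const_eq0 fc => //.
  by move=> P /Ps_quad[m [d [d0 ->]]]; exact: normalized_irr_quad.
right; case: (ap) (aq) => [pi0 pi1 injp o0 n0] [pi0' pi1' injq o0' n0'].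
have cp0 k : 0 < cp k by do 2![apply: mulr_gt0 => //].
have cq0 k : 0 < cq k by do 2![apply: mulr_gt0 => //].
have pq k : exists j, [/\ loc q j = loc p k, spread q = spread p & cq j = cp k].
  apply: weights_match => // i; apply/eqP; rewrite -subr_eq0.
  by have /eqP := c0 _ (pPs i).
have qp k : exists j, [/\ loc p j = loc q k, spread p = spread q & cp j = cq k].
  apply: weights_match => // i; apply/eqP; rewrite eq_sym -subr_eq0.
  by have /eqP := c0 _ (qPs i).
have [f fP] := choice pq; have [g gP] := choice qp.
have fK : cancel f g.
  by move=> k; apply: injp; have [-> _ _] := gP (f k); have [] := fP k.
have gK : cancel g f.
  by move=> k; apply: injq; have [-> _ _] := fP (g k); have [] := gP k.
have bij_f : bijective f by exists g.
have spread_eq : spread q = spread p.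
  have [k _|none] := pickP (fun k : 'I_(ncomp p) => true);
    first by have [] := fP k.
  by move: pi1; rewrite big_pred0// => /eqP; rewrite eq_sym oner_eq0.
have omega2_eq : omega2 p = omega2 q.
  by move: spread_eq; rewrite /spread nu_pq => /mulIf ->//; rewrite gt_eqF.
have W_eq : tail_weight q = tail_weight p.
  by apply: eq_tail_weight; [exact: esym|exact: esym].
have sumq : \sum_(k < ncomp p) prop q (f k) = 1.
  by rewrite -pi1' [RHS](reindex f)//; exact: onW_bij.
(* Summing the matched weights over all components removes the proportions, as both families sum to
   1. *)
have ll' : l = l'.
  apply: (mulIf (x := tail_weight p)); first by rewrite gt_eqF.
  rewrite -[LHS]mulr1 -pi1 -[RHS]mulr1 -sumq !mulr_sumr; apply: eq_bigr => k _.
  by have [_ _] := fP k; rewrite /cp /cq W_eq !mulrA => ->.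
have prop_eq k : prop q (f k) = prop p k.
  have l'N : l' != 0 by rewrite gt_eqF.
  have WN : tail_weight p != 0 by rewrite gt_eqF.
  by have [_ _] := fP k; rewrite /cp /cq W_eq ll' => /(mulfI l'N)/(mulfI WN).
have loc_eq k : loc q (f k) = loc p k by have [] := fP k.
split=> //.
- by have := bij_eq_card bij_f; rewrite !card_ord.
- apply/seteqP; split => [_ [k _ <-]|_ [k _ <-]].
    by exists (f k) => //; rewrite prop_eq loc_eq.
  by exists (g k) => //; rewrite -prop_eq -loc_eq gK.
- move=> u; rewrite /density_at_infinity [RHS](reindex f)/=;
    last exact: onW_bij.
  by apply: eq_bigr => k _; rewrite W_eq prop_eq loc_eq spread_eq hpq.
Qed.

End Comparison.

(** * Recovery of the parameters from the two tails *)

Section ObservedTails.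
Variables (R : realType) (F : R -> R).
Hypotheses (F_strict : {homo F : x y / x < y})
  (F_Ny : F x @[x --> -oo] --> (0 : R)) (F_y : F x @[x --> +oo] --> (1 : R)).

Let F_gt0 := selection_gt0 F_strict F_Ny.

(* [e = 1] and [e = -1] select the tails at [+oo] and [-oo] respectively. *)
Definition tail_factor (p : t_mixture_params R) (e v : R) : R :=
  density_at_infinity p (e * v) * F (alpha p + (e * beta p) * v^-1).

Definition tail_limit (p : t_mixture_params R) (e : R) : R :=
  tail_weight p * selection_limit F (alpha p) (e * beta p).

Lemma cvg_tail_factor p e : admissible p ->
  tail_factor p e v @[v --> (0 : R)^'+] --> tail_limit p e.
Proof.
move=> ap; apply: cvgM; last exact: cvg_selection.
have e0 : e * v @[v --> (0 : R)^'+] --> (0 : R).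
  apply: cvg_at_right_filter; rewrite -[X in _ --> X](mulr0 e).
  by apply: cvgMr; exact: cvg_id.
exact: (cvg_comp _ _ e0 (cvg_density_at_infinity ap)).
Qed.

Lemma tail_factor_gt0 p e v : admissible p -> 0 < tail_factor p e v.
Proof. by move=> ap; rewrite mulr_gt0 ?density_at_infinity_gt0. Qed.

Lemma observed_tail p e v : admissible p -> e ^+ 2 = 1 -> 0 < v ->
  observed F p (e * v)^-1 = v `^ (nu p + 1) * tail_factor p e v.
Proof.
move=> ap e2 v0; have e0 : e != 0.
  by apply/eqP => e0; move: e2 => /eqP; rewrite e0 expr0n eq_sym oner_eq0.
have eV : e^-1 = e by apply: (mulfI e0); rewrite mulfV// -e2 expr2.
have ne : `|e| = 1 by apply/eqP; rewrite -sqrp_eq1// -normrX e2 normr1.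
rewrite observed_at_infinity ?mulf_neq0 ?(gt_eqF v0)//.
rewrite normrM ne mul1r gtr0_norm// -mulrA invfM eV /tail_factor.
by congr (_ * (_ * F (_ + _))); ring.
Qed.

Variables p q : t_mixture_params R.
Hypotheses (ap : admissible p) (aq : admissible q)
  (obs : observed F p =1 observed F q).

Lemma tail_relation e v : e ^+ 2 = 1 -> 0 < v ->
  v `^ (nu p + 1) * tail_factor p e v = v `^ (nu q + 1) * tail_factor q e v.
Proof. by move=> e2 v0; rewrite -!observed_tail. Qed.

(** Cross-multiplying the relations at the two tails cancels the powers of [v] while [nu] is still
    unknown. In the limit the pairs of selection limits at the two ends, [(1, 0)], [(0, 1)] or
    [(F a, F a)] according to the sign of the slope, must be proportional. *)
Lemma beta_same_sign : beta p = 0 /\ beta q = 0 \/ 0 < beta p * beta q.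
Proof.
have prod_eq v : 0 < v ->
    tail_factor p 1 v * tail_factor q (-1) v
      = tail_factor q 1 v * tail_factor p (-1) v.
  move=> v0; have t1 := tail_relation (expr1n R 2) v0.
  have sN1 : (-1) ^+ 2 = 1 :> R by rewrite sqrrN expr1n.
  have t2 := tail_relation sN1 v0.
  have a0 : v `^ (nu p + 1) != 0 by rewrite gt_eqF// powR_gt0.
  apply: (mulfI a0); rewrite mulrA t1 [RHS]mulrCA t2; ring.
have lim1 : tail_factor p 1 v * tail_factor q (-1) v @[v --> (0 : R)^'+] -->
    tail_limit p 1 * tail_limit q (-1) by apply: cvgM; exact: cvg_tail_factor.
have lim2 : tail_factor p 1 v * tail_factor q (-1) v @[v --> (0 : R)^'+] -->
    tail_limit q 1 * tail_limit p (-1).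
  have : tail_factor q 1 v * tail_factor p (-1) v @[v --> (0 : R)^'+] -->
    tail_limit q 1 * tail_limit p (-1) by apply: cvgM; exact: cvg_tail_factor.
  apply: cvg_trans; apply: near_eq_cvg; near=> v.
  by rewrite /= prod_eq//; near: v; exact: nbhs_right_gt.
have : tail_limit p 1 * tail_limit q (-1) = tail_limit q 1 * tail_limit p (-1).
  exact: cvg_unique lim1 lim2.
have W0 := mulf_neq0 (lt0r_neq0 (tail_weight_gt0 ap))
  (lt0r_neq0 (tail_weight_gt0 aq)).
rewrite /tail_limit (mul1r (beta _)) (mul1r (beta _)) (mulN1r (beta _))
  (mulN1r (beta _)).
rewrite mulrACA [RHS]mulrACA [tail_weight q * _]mulrC.
move=> /(mulfI W0); rewrite /selection_limit !oppr_gt0 !oppr_lt0.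
have Fp := gt_eqF (F_gt0 (alpha p)); have Fq := gt_eqF (F_gt0 (alpha q)).
have [bp|bp|bp] := ltgtP 0 (beta p); have [bq|bq|bq] := ltgtP 0 (beta q);
  rewrite ?mul1r ?mul0r ?mulr1 ?mulr0 => /eqP;
  rewrite ?eqxx ?oner_eq0 ?Fp ?Fq 1?eq_sym ?oner_eq0 ?Fp ?Fq// => _.
- by right; exact: mulr_gt0.
- by right; rewrite nmulr_rgt0.
- by left.
Unshelve. all: by end_near. Qed.

Lemma nu_eq : nu p = nu q.
Proof.
(* At this end neither selection probability tends to 0, so [v] to the power [nu p - nu q] has a
   positive limit. *)
pose e : R := if 0 <= beta p then 1 else -1.
have e2 : e ^+ 2 = 1 by rewrite /e; case: ifP; rewrite ?sqrrN expr1n.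
have ebp : 0 <= e * beta p.
  rewrite /e; case: ifPn => [b0|]; first by rewrite mul1r.
  by rewrite -ltNge mulN1r oppr_ge0 => /ltW.
have ebq : 0 <= e * beta q.
  rewrite /e; case: beta_same_sign => [[-> ->]|]; first by rewrite mulr0.
  case: ifPn => [b0|]; rewrite ?mul1r ?mulN1r ?oppr_ge0.
    rewrite le0r in b0; case/predU1P: b0 => [->|b0];
      first by rewrite mul0r ltxx.
    by rewrite pmulr_rgt0// => /ltW.
  by rewrite -ltNge => b0; rewrite nmulr_rgt0// => /ltW.
have lim_gt0 r : admissible r -> 0 <= e * beta r -> 0 < tail_limit r e.
  move=> ar er; rewrite mulr_gt0 ?tail_weight_gt0// /selection_limit.
  by case: ifPn => // _; rewrite ifN ?F_gt0// -leNgt.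
have Lp := lim_gt0 _ ap ebp; have Lq := lim_gt0 _ aq ebq.
suff : nu p - nu q = 0 by move/eqP; rewrite subr_eq0 => /eqP.
apply: (@powR_cvg_eq0 R _ (tail_limit q e / tail_limit p e));
  first by rewrite divr_gt0.
have : tail_factor q e v / tail_factor p e v @[v --> (0 : R)^'+] -->
    tail_limit q e / tail_limit p e.
  apply: cvgM; first exact: cvg_tail_factor.
  by apply: cvgV; [rewrite gt_eqF|exact: cvg_tail_factor].
apply: cvg_trans; apply: near_eq_cvg; near=> v.
have v0 : 0 < v by near: v; exact: nbhs_right_gt.
have tp := lt0r_neq0 (tail_factor_gt0 e v ap).
have -> : nu p - nu q = (nu p + 1) - (nu q + 1) by ring.
rewrite powRB ?(gt_eqF v0) ?implybT//=.
have vq : v `^ (nu q + 1) != 0 by rewrite gt_eqF// powR_gt0.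
apply/eqP; rewrite eqr_div//; apply/eqP.
by rewrite tail_relation// mulrC.
Unshelve. all: by end_near. Qed.

Lemma density_relation u : u != 0 ->
  density_at_infinity p u * F (alpha p + beta p * u^-1)
  = density_at_infinity q u * F (alpha q + beta q * u^-1).
Proof.
move=> u0; have := obs u^-1; rewrite !observed_at_infinity// nu_eq -!mulrA.
by apply: mulfI; rewrite gt_eqF// powR_gt0// normr_gt0.
Qed.

(** If [M] were 0, [E] would tend to [C]; but at the end where both arguments go to [+oo] the ratio
    of the values of [F] tends to 1, so [C] would be 0. *)
Lemma remainder_order_gt0 (E : R -> R) (M : nat) (C : R) :
  0 < beta p * beta q ->
  (forall y, F (alpha p + beta p * y) = F (alpha q + beta q * y) * (1 + E y)) ->
  C != 0 -> E u^-1 / u ^+ M @[u --> 0^'] --> C -> (0 < M)%N.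
Proof.
move=> bb FE C0; rewrite lt0n; apply: contraPneq => ->;
  under eq_fun do rewrite expr0 divr1.
move=> EC.
pose e : R := Num.sg (beta p).
have bp : beta p != 0 by apply: contraTneq bb => ->; rewrite mul0r ltxx.
have e0 : e != 0 by rewrite /e sgr_eq0.
have eV : e^-1 = e by rewrite /e invr_sg.
have ebp : 0 < e * beta p by rewrite -normrEsg normr_gt0.
have ebq : 0 < e * beta q.
  move: bb; rewrite [beta p]numEsg -/e mulrAC pmulr_lgt0// normr_gt0//.
have eN : e * v @[v --> (0 : R)^'+] --> (0 : R)^'.
  move=> A [d /= d0 dA]; exists d => //= v vd v0; apply: dA.
    by move: vd; rewrite /ball/= !sub0r !normrN normrM normr_sg bp mul1r.
  by rewrite mulf_neq0// gt_eqF.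
have l1 : E (e * v)^-1 @[v --> (0 : R)^'+] --> C by exact: (cvg_comp _ _ eN EC).
have selection1 r : 0 < e * beta r ->
    F (alpha r + (e * beta r) * v^-1) @[v --> (0 : R)^'+] --> (1 : R).
  by move=> er; have := @cvg_selection R F F_Ny F_y (alpha r) (e * beta r);
    rewrite /selection_limit er.
have l2 : F (alpha q + (e * beta q) * v^-1) * (1 + E (e * v)^-1)
    @[v --> (0 : R)^'+] --> 1 * (1 + C).
  by apply: cvgM; [exact: selection1|apply: cvgD => //; exact: cvg_cst].
have l3 : F (alpha q + (e * beta q) * v^-1) * (1 + E (e * v)^-1)
    @[v --> (0 : R)^'+] --> (1 : R).
  have := selection1 p ebp; apply: cvg_trans; apply: near_eq_cvg; near=> v.
  rewrite /= (_ : e * beta p * v^-1 = beta p * (e * v)^-1).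
    by rewrite FE invfM eV mulrCA mulrA.
  by rewrite invfM eV mulrCA mulrA.
have : 1 * (1 + C) = 1 by exact: cvg_unique l2 l3.
rewrite mul1r => /eqP; rewrite -subr_eq0 addrAC subrr add0r.
exact/negP.
Unshelve. all: by end_near. Qed.

Lemma parameters_eq : tail_condition F ->
  [/\ ncomp p = ncomp q, components p = components q, omega2 p = omega2 q,
      nu p = nu q & alpha p = alpha q /\ beta p = beta q].
Proof.
move=> F_tails.
have F_inj x y : F x = F y -> x = y.
  by move=> Fxy; have [/F_strict|/F_strict|//] := ltgtP x y; rewrite Fxy ltxx.
have [[bp bq]|bb] := beta_same_sign.
  have [[M [C C0]]|[Fpq ? ? ? _]] :=
      density_comparison ap aq nu_eq (F_gt0 (alpha p)) (F_gt0 (alpha q));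
        last first.
    by split=> //; [exact: nu_eq|split; [exact: F_inj|rewrite bp bq]].
  move=> L.
  (* With zero slopes this difference vanishes identically for [u != 0], which excludes a leading
     term. *)
  have L0 : (F (alpha p) * density_at_infinity p u
      - F (alpha q) * density_at_infinity q u) / u ^+ M @[u --> 0^']
        --> (0 : R).
    have : cst 0 u @[u --> (0 : R)^'] --> (0 : R) by exact: cvg_cst.
    apply: cvg_trans; apply: near_eq_cvg; near=> u.
    have u0 : u != 0 by near: u; exact: nbhs_dnbhs_neq.
    have := density_relation u0; rewrite bp bq !mul0r !addr0 /= => E.
    by rewrite ![F _ * _]mulrC E subrr mul0r.
  have C00 : C = 0 by exact: cvg_unique L L0.
  by rewrite C00 eqxx in C0.
have [[M [C C0 L]]|[_ ? ? ? gpq]] :=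
  density_comparison ap aq nu_eq ltr01 ltr01; last first.
  (* Equal densities cancel, and [F] is injective; the points [u = 1] and [u = -1] then determine
     the affine argument. *)
  have lin u : u != 0 -> alpha p + beta p * u^-1 = alpha q + beta q * u^-1.
    move=> u0; apply: F_inj; have := density_relation u0; rewrite gpq.
    by apply: mulfI; rewrite gt_eqF// density_at_infinity_gt0.
  have N10 : -1 != 0 :> R by rewrite oppr_eq0 oner_eq0.
  have := lin _ (oner_neq0 R); have := lin _ N10.
  rewrite invrN1 invr1 => l1 l2; split=> //; first exact: nu_eq.
  by split; lra.
pose E y := F (alpha p + beta p * y) / F (alpha q + beta q * y) - 1.
have FE y : F (alpha p + beta p * y) = F (alpha q + beta q * y) * (1 + E y).
  by rewrite /E [1 + _]addrC subrK mulrCA mulfV ?mulr1// gt_eqF.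
(* By [density_relation], [E u^-1] is minus the difference of the two densities divided by that of
   [p], which tends to [tail_weight p]. *)
have EL : E u^-1 / u ^+ M @[u --> 0^'] --> - (C / tail_weight p).
  have : - ((1 * density_at_infinity p u - 1 * density_at_infinity q u) / u ^+ M
      / density_at_infinity p u) @[u --> (0 : R)^'] --> - (C / tail_weight p).
    apply: cvgN; apply: cvgM => //; apply: cvgV.
      by rewrite gt_eqF// tail_weight_gt0.
    by apply: cvg_within_filter; exact: cvg_density_at_infinity.
  apply: cvg_trans; apply: near_eq_cvg; near=> u.
  have u0 : u != 0 by near: u; exact: nbhs_dnbhs_neq.
  have gp := lt0r_neq0 (density_at_infinity_gt0 u ap).
  have Fq := lt0r_neq0 (F_gt0 (alpha q + beta q * u^-1)).
  have uM : u ^+ M != 0 by rewrite expf_neq0.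
  rewrite /E /=; have -> : F (alpha p + beta p * u^-1)
      = density_at_infinity q u * F (alpha q + beta q * u^-1) /
        density_at_infinity p u.
    by rewrite -density_relation// mulrAC mulfV// mul1r.
  by field; rewrite uM gp Fq.
have C'0 : - (C / tail_weight p) != 0.
  by rewrite oppr_eq0 mulf_neq0// invr_neq0// gt_eqF// tail_weight_gt0.
have M0 := remainder_order_gt0 bb FE C'0 EL.
have := remainder_eq0 F_strict F_Ny F_y F_tails bb FE M0 EL.
by move/eqP; rewrite (negPf C'0).
Unshelve. all: by end_near. Qed.

End ObservedTails.

(* [cumulativeBounded 0 1]: nondecreasing, right-continuous, with limits 0 at
   -oo and 1 at +oo. *)
Theorem theorem5 (R : realType) (F : cumulativeBounded (0 : R) (1 : R))
  (F_strict : {homo (F : R -> R) : x y / x < y})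
  (F_support : cdf_support F = [set: R])
  (F_tails : tail_condition F) :
  identifiable F.
Proof.
move=> p q ap aq obs.
exact: (parameters_eq F_strict (cumulativeNy F) (cumulativey F) ap aq obs
  F_tails).
Qed.
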